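(* Let $(\Omega,\mathcal F,\nu)$ be a probability space, let $\mathcal W:\Omega\to\mathbb R$ be measurable with $\mathcal Z:=\mathbb E_\nu[e^{-\mathcal W}]<\infty$, and let $\nu^*$ be the optimal proposal measure defined by $\frac{\mathrm d\nu^*}{\mathrm d\nu}=\frac{e^{-\mathcal W}}{\mathcal Z}$. Let $\widetilde\nu$ be a probability measure on $(\Omega,\mathcal F)$ with $\widetilde\nu\ll\nu$ and $\nu\ll\widetilde\nu$. Set $$m=\inf_{E\in\mathcal F,\ \widetilde\nu(E)>0}\frac{\nu^*(E)}{\widetilde\nu(E)},\qquad M=\sup_{E\in\mathcal F,\ \widetilde\nu(E)>0}\frac{\nu^*(E)}{\widetilde\nu(E)}.$$ Then the relative error $$r(\widetilde\nu)=\frac{1}{\mathcal Z}\sqrt{\operatorname{Var}_{\widetilde\nu}\left(e^{-\mathcal W}\frac{\mathrm d\nu}{\mathrm d\widetilde\nu}\right)}$$ satisfies $$\sqrt{e^{m\operatorname{KL}(\widetilde\nu|\nu^* )+\operatorname{KL}(\nu^*|\widetilde\nu)}-1}\ \le\ r(\widetilde\nu)\ \le\ \sqrt{e^{M\operatorname{KL}(\widetilde\nu|\nu^* )+\operatorname{KL}(\nu^*|\widetilde\nu)}-1}.$$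
   Context: For probability measures $\mu\ll\lambda$, $\operatorname{KL}(\mu|\lambda)=\mathbb E_{\mu}\left[\log\frac{\mathrm d\mu}{\mathrm d\lambda}\right]$ is the Kullback-Leibler divergence. One has $m\in[0,1]$ and $M\in[1,\infty]$. All quantities may take the value $+\infty$, with the convention $0\cdot\infty=0$. *)

(* Defs.v *)
From mathcomp Require Import all_boot all_order all_algebra.
From mathcomp Require Import all_classical all_reals all_analysis.

Set Implicit Arguments.
Unset Strict Implicit.
Unset Printing Implicit Defensive.

Import Order.TTheory GRing.Theory Num.Theory.

Local Open Scope classical_set_scope.
Local Open Scope ring_scope.
Local Open Scope ereal_scope.
Local Open Scope charge_scope.

Section definitions.
Context {d : measure_display} {T : measurableType d} {R : realType}.
Implicit Types (mu la nu : probability T R) (W : T -> R).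

Definition density mu la : T -> \bar R :=
  'd (charge_of_finite_measure mu) '/d la.

(* Meaningful when mu `<< la. Since lne 0 = -oo, log (dmu/dla) is extended
   real valued; its negative part is mu-integrable, so the integral is never
   of the form +oo - +oo, and KL mu la = +oo is possible. *)
Definition KL mu la : \bar R := \int[mu]_x lne (density mu la x).

Definition partition_function nu W : \bar R :=
  'E_nu[fun x => expR (- W x)].

(* As usual, an equation between Radon-Nikodym derivatives is understood
   almost everywhere. *)
Definition is_optimal_proposal nu W (nustar : probability T R) : Prop :=
  nustar `<< nu /\
  ae_eq nu setT (density nustar nu)
    (fun x => (expR (- W x))%:E / partition_function nu W).

Definition measure_ratios mu la : set (\bar R) :=
  [set mu E / la E | E in [set E : set T | measurable E /\ 0 < la E]].

(* The derivative dnu/dnutilde is finite everywhere when nu `<< nutilde, so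
   fine loses nothing. The variance, hence r, is +oo when the weight is not
   square-integrable. *)
Definition relative_error nu W (nutilde : probability T R) : \bar R :=
  (partition_function nu W)^-1 *
  sqrte ('V_nutilde[fun x => (expR (- W x) * fine (density nu nutilde x))%R]).

End definitions.

(* Main.v *)
(** Write P for the optimal measure, Q for the proposal and g := dP/dQ, so that
    the relative error is sqrt V with V := Var_Q g = int (g - 1)^2 dQ.  Since g
    has Q-mean 1, KL(Q|P) = int u dQ and KL(P|Q) = int (g ln g - g + 1) dQ with
    u := g - 1 - ln g >= 0, both integrands being nonnegative; pointwise
    (g - 1)^2 = g u + (g ln g - g + 1), hence V = int u dP + KL(P|Q).
    As P <= M Q this gives V <= M KL(Q|P) + KL(P|Q), and 1 + x <= e^x yields the
    upper bound.  For the lower bound put a := 1 + V = int g dP and replace u by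
    the tangent-line defect t := ln a + g/a - 1 - ln g >= 0 of ln at a: then
    int t dP + KL(P|Q) = ln a, while int t dP >= m int t dQ >= m KL(Q|P). *)
Require Import Defs.
From mathcomp Require Import all_boot all_order all_algebra.
From mathcomp Require Import all_classical all_reals all_analysis.
From mathcomp Require Import measurable_realfun ring lra.

Set Implicit Arguments.
Unset Strict Implicit.
Unset Printing Implicit Defensive.

Import Order.TTheory GRing.Theory Num.Theory.

Local Open Scope classical_set_scope.
Local Open Scope ring_scope.
Local Open Scope ereal_scope.

(** * Measurability of [lne], and comparison of possibly infinite integrals *)

Lemma measurable_lne (R : realType) (d : measure_display)
    (T : measurableType d) (f : T -> \bar R) :
  measurable_fun setT f -> measurable_fun setT (fun x => lne (f x)).
Proof.
move=> mf; have -> : (fun x => lne (f x)) = (fun x =>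
    if f x <= 0 then -oo else if f x == +oo then +oo else (ln (fine (f x)))%:E).
  apply/funext => x; case: (f x) => [r||]/=; rewrite ?leye_eq ?leNye//.
apply: measurable_fun_ifT => //.
  exact: measurable_fun_lee.
apply: measurable_fun_ifT => //.
  exact: measurable_fun_eqe.
apply/measurable_EFinP; apply: measurableT_comp => //.
exact: measurableT_comp.
Qed.

(** Turns a signed integrand into a nonnegative one even when the integral is infinite: since
    [f >= - k], the negative part of [f] is at most [|k|], hence has finite integral, so both sides
    become [+oo] together. *)
Lemma integral_addr_mean0 (R : realType) (d : measure_display)
    (T : measurableType d) (mu : {measure set T -> \bar R}) (f k : T -> R) :
  measurable_fun setT f -> mu.-integrable setT (EFin \o k) ->
  \int[mu]_x (k x)%:E = 0 -> (forall x, 0 <= f x + k x)%R ->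
  \int[mu]_x (f x)%:E = \int[mu]_x (f x + k x)%:E.
Proof.
move=> mf ik k0 fk0.
have mk : measurable_fun setT k by apply/measurable_EFinP/measurable_int/ik.
have mfk : measurable_fun setT (EFin \o (f \+ k)%R).
  by apply/measurable_EFinP; exact: measurable_funD.
have [fkoo|] := ltP (\int[mu]_x (f x + k x)%:E) +oo.
  have ifk : mu.-integrable setT (EFin \o (f \+ k)%R).
    apply/integrableP; split => //.
    by under eq_integral do rewrite gee0_abs ?lee_fin//=.
  have -> : (fun x => (f x)%:E) = (EFin \o (f \+ k)%R) \- (EFin \o k).
    by apply/funext => x /=; rewrite -EFinB addrK.
  by rewrite integralB// k0 sube0.
rewrite leye_eq => /eqP fkoo; rewrite fkoo.
have inf : \int[mu]_x (EFin \o f)^\- x < +oo.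
  have /integrableP[_] := ik; apply: le_lt_trans.
  apply: ge0_le_integral => //.
  - by apply: measurable_funeneg; exact/measurable_EFinP.
  - by apply: measurableT_comp => //; exact/measurable_EFinP.
  - move=> x _; rewrite funenegE /= -EFin_max lee_fin ge_max normr_ge0 andbT.
    by rewrite (le_trans _ (ler_norm _))//; have := fk0 x; lra.
(* Otherwise [f + k <= f^+ + |k|] would have a finite integral. *)
have ipf : \int[mu]_x (EFin \o f)^\+ x = +oo.
  apply/eqP; rewrite eq_le leey /= leNgt; apply/negP => pf.
  have := fkoo; apply/eqP; rewrite lt_eqF//.
  apply: (@le_lt_trans _ _ (\int[mu]_x ((EFin \o f)^\+ x + `|(EFin \o k) x|))).
    apply: ge0_le_integral => //.
    - by move=> x _; rewrite lee_fin.
    - apply: emeasurable_funD.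
        by apply: measurable_funepos; exact/measurable_EFinP.
      by apply: measurableT_comp => //; exact/measurable_EFinP.
    - move=> x _; rewrite /= EFinD; apply: leeD; rewrite ?lee_fin ?ler_norm//.
      by rewrite funeposE /= le_max lexx.
  rewrite ge0_integralD//.
  - by rewrite lte_add_pinfty//; have /integrableP[] := ik.
  - by apply: measurable_funepos; exact/measurable_EFinP.
  - by apply: measurableT_comp => //; exact/measurable_EFinP.
rewrite integralE ipf addye//.
by rewrite -ltNye lteNr.
Qed.

(** Here [h - f] may change sign, so pointwise monotonicity does not apply. Either the right side is
    [+oo], or [h] is integrable and [f = h - (h - f)] is integrated term by term. *)
Lemma le_integral_of_diff (R : realType) (d : measure_display)
    (T : measurableType d) (mu : {measure set T -> \bar R}) (f h : T -> R) :
  measurable_fun setT f -> measurable_fun setT h ->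
  (forall x, 0 <= f x)%R -> (forall x, 0 <= h x)%R ->
  mu.-integrable setT (EFin \o (h \- f)%R) ->
  0 <= \int[mu]_x (h x - f x)%:E ->
  \int[mu]_x (f x)%:E <= \int[mu]_x (h x)%:E.
Proof.
move=> mf mh f0 h0 ihf hf0.
have [hoo|] := ltP (\int[mu]_x (h x)%:E) +oo; last first.
  by rewrite leye_eq => /eqP ->; rewrite leey.
have ih : mu.-integrable setT (EFin \o h).
  apply/integrableP; split; first exact/measurable_EFinP.
  by under eq_integral do rewrite gee0_abs ?lee_fin//=.
have -> : (fun x => (f x)%:E) = (EFin \o h) \- (EFin \o (h \- f)%R).
  by apply/funext => x /=; rewrite -EFinB subKr.
by rewrite integralB// leeBlDr ?leeDl//; exact: integrable_fin_num.
Qed.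

(** * Change of measure and a positive version of the density *)

Section density.
Context {d : measure_display} {T : measurableType d} {R : realType}.
Variables (P Q : probability T R).
Hypothesis PQ : P `<< Q.

Lemma ge0_integral_density (f : T -> \bar R) (A : set T) :
  measurable A -> measurable_fun A f -> (forall x, 0 <= f x) ->
  \int[P]_(x in A) f x = \int[Q]_(x in A) (f x * density P Q x).
Proof.
move=> mA mf f0.
(* The change of variables is stated for the finite nonnegative version
   [Radon_Nikodym_SigmaFinite.f], which agrees [Q]-a.e. with [density P Q]. *)
rewrite -(Radon_Nikodym_SigmaFinite.change_of_variables PQ)//.
have mD : measurable_fun A (density P Q).
  by apply: measurable_funTS; apply: measurable_int; exact: Radon_Nikodym_integrable.
have mF : measurable_fun A (Radon_Nikodym_SigmaFinite.f P Q).
  by apply: measurable_funTS; apply: measurable_int;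
     exact: Radon_Nikodym_SigmaFinite.f_integrable.
apply: ae_eq_integral => //; try exact: emeasurable_funM.
exact/ae_eqe_mul2l/ae_eq_Radon_Nikodym_SigmaFinite.
Qed.

(* Positivity everywhere, and not just almost everywhere, lets the inequalities
   on ln (where ln 0 = 0) be used pointwise. *)
Lemma density_gt0_version : Q `<< P ->
  exists g : T -> R, [/\ measurable_fun setT g, forall x, (0 < g x)%R &
    ae_eq Q setT (density P Q) (EFin \o g)].
Proof.
move=> QP; pose f := Radon_Nikodym_SigmaFinite.f P Q.
have f0 x : 0 <= f x by exact: Radon_Nikodym_SigmaFinite.f_ge0.
have ff x : f x \is a fin_num by exact: Radon_Nikodym_SigmaFinite.f_fin_num.
have mf : measurable_fun setT f.
  by apply: measurable_int; exact: Radon_Nikodym_SigmaFinite.f_integrable.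
(* On [S] the density vanishes, so [S] is [P]-null, hence [Q]-null by [QP]; the value there can be
   reset to 1. *)
pose S := [set x | f x <= 0].
have mS : measurable S by rewrite -[S]setTI; exact: measurable_lee.
have PS : P S = 0.
  rewrite (Radon_Nikodym_SigmaFinite.f_integral PQ)//; apply: integral0_eq => x.
  by rewrite /S/= => fx; apply/eqP; rewrite eq_le fx/=; exact: f0.
have QS : Q S = 0 by move/null_content_dominatesP : QP; exact.
exists (fun x => if f x <= 0 then 1%R else fine (f x)); split.
- apply: measurable_fun_ifT => //; first exact: measurable_fun_lee.
  exact: measurableT_comp.
- by move=> x; case: ifPn => // ; rewrite -ltNge => fx; rewrite -lte_fin fineK.
- apply: (ae_eq_trans (ae_eq_sym (ae_eq_Radon_Nikodym_SigmaFinite PQ measurableT))).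
  exists S; split => // x /=; apply: contra_notP => fx _.
  by rewrite ifN ?fineK//; apply/negP.
Qed.

End density.

(** * Tangent-line bounds for [ln] *)

Lemma ln_le_subr1 (R : realType) (x : R) : (0 < x)%R -> (ln x <= x - 1)%R.
Proof. by move=> x0; rewrite -{1}[x](subrKC 1) le_ln1Dx//; lra. Qed.

(** This is [ln_le_subr1] at [x^-1], multiplied by [x]. *)
Lemma mul_ln_ge_subr1 (R : realType) (x : R) :
  (0 < x)%R -> (x - 1 <= x * ln x)%R.
Proof.
move=> x0; have := @ln_le_subr1 R x^-1; rewrite invr_gt0 => /(_ x0).
rewrite lnV// -(ler_pM2l x0) mulrBr divff ?gt_eqF//; lra.
Qed.

(** * Divergences and variance as [Q]-integrals of the positive density [g] *)

Section positive_density.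
Context {d : measure_display} {T : measurableType d} {R : realType}.
Variables (P Q : probability T R) (g : T -> R).
Hypotheses (PQ : P `<< Q) (QP : Q `<< P).
Hypotheses (mg : measurable_fun setT g) (g_gt0 : forall x, (0 < g x)%R).
Hypothesis dPQ : ae_eq Q setT (density P Q) (EFin \o g).

Let mln : measurable_fun setT (fun x => ln (g x)).
Proof. exact: measurableT_comp. Qed.

Let mD (P' Q' : probability T R) : P' `<< Q' -> measurable_fun setT (density P' Q').
Proof. by move=> h; apply: measurable_int; exact: Radon_Nikodym_integrable. Qed.

Lemma ge0_integral_positive_density (f : T -> \bar R) (A : set T) :
  measurable A -> measurable_fun A f -> (forall x, 0 <= f x) ->
  \int[P]_(x in A) f x = \int[Q]_(x in A) (f x * (g x)%:E).
Proof.
move=> mA mf f0; rewrite (ge0_integral_density PQ)//; apply: ae_eq_integral => //.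
- by apply: emeasurable_funM => //; exact/measurable_funTS/mD.
- by apply: emeasurable_funM => //; exact/measurable_funTS/measurable_EFinP.
- by apply: ae_eqe_mul2l; exact: (ae_eq_subset _ dPQ).
Qed.

(** Multiplication by [g > 0] commutes with taking positive and negative parts, so the nonnegative
    case applies to each part separately. *)
Lemma integral_positive_density (h : T -> R) : measurable_fun setT h ->
  \int[P]_x (h x)%:E = \int[Q]_x (g x * h x)%:E.
Proof.
move=> mh; rewrite integralE [RHS]integralE; congr (_ - _).
- rewrite ge0_integral_positive_density//.
  + apply: eq_integral => x _; rewrite !funeposE /= -!EFin_max -EFinM.
    by rewrite maxr_pMl ?mul0r ?(ltW (g_gt0 _))// mulrC.
  + by apply: measurable_funepos; exact/measurable_EFinP.
- rewrite ge0_integral_positive_density//.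
  + apply: eq_integral => x _; rewrite !funenegE /= -!EFin_max -EFinM.
    by rewrite maxr_pMl ?mul0r ?(ltW (g_gt0 _))// mulrC mulrN.
  + by apply: measurable_funeneg; exact/measurable_EFinP.
Qed.

Lemma integral_density1 : \int[Q]_x (g x)%:E = 1.
Proof.
have := @integral_positive_density (cst 1%R) (measurable_cst _).
under [in RHS]eq_integral do rewrite mulr1.
by move=> <-; rewrite (integral_cst P measurableT 1) mul1e; exact: probability_setT.
Qed.

Lemma integrable_density : Q.-integrable setT (EFin \o g).
Proof.
apply/integrableP; split; first exact/measurable_EFinP.
under eq_integral do rewrite gee0_abs ?lee_fin ?(ltW (g_gt0 _))//=.
by rewrite integral_density1 ltry.
Qed.

(** Over every measurable [E], the [P]-integral of [g^-1] is the [Q]-integral of [g^-1 * g = 1],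
    that is [Q E]. This identifies the derivative [P]-a.e., hence [Q]-a.e. *)
Lemma density_inv : ae_eq Q setT (density Q P) (fun x => (g x)^-1%:E).
Proof.
have mV : measurable_fun setT (fun x => (g x)^-1%:E).
  have -> : (fun x => (g x)^-1%:E) = (fun x => (expR (- ln (g x)))%:E).
    by apply/funext => x; rewrite expRN lnK ?posrE.
  apply/measurable_EFinP; apply: measurableT_comp => //.
  exact: measurableT_comp.
apply: (null_dominates_ae_eq measurableT QP); apply: integral_ae_eq => //.
- exact: Radon_Nikodym_integrable.
- move=> E _ mE; rewrite -Radon_Nikodym_integral//.
  rewrite ge0_integral_positive_density//.
  + under eq_integral do rewrite -EFinM mulVf ?gt_eqF//.
    by have := integral_cst Q mE 1; rewrite mul1e => /esym.
  + exact: measurable_funTS.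
  + by move=> x; rewrite lee_fin invr_ge0 ltW.
Qed.

(** The correction [1 - g] has [Q]-mean 0 and makes [g * ln g] nonnegative, so [integral_addr_mean0]
    covers an infinite divergence as well. *)
Lemma KL_density : KL P Q = \int[Q]_x (g x * ln (g x) - g x + 1)%:E.
Proof.
transitivity (\int[P]_x (ln (g x))%:E).
  apply: ae_eq_integral => //.
  - exact/measurable_lne/mD.
  - exact/measurable_EFinP.
  - have := null_dominates_ae_eq measurableT PQ dPQ.
    by apply: filterS => x /[apply] ->; rewrite lne_EFin.
rewrite integral_positive_density//.
rewrite (integral_addr_mean0 (k := fun x => 1 - g x)%R).
- by apply: eq_integral => x _; congr (_%:E); ring.
- exact: measurable_funM.
- exact: (integrableB _ (finite_measure_integrable_cst _ 1 _) integrable_density).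
- under eq_integral do rewrite EFinB.
  rewrite integralB_EFin//.
  + rewrite integral_density1 (integral_cst Q measurableT 1) mul1e.
    by rewrite [X in X - _]probability_setT subee.
  + exact: (finite_measure_integrable_cst Q 1 measurableT).
  + exact: integrable_density.
- by move=> x; have := mul_ln_ge_subr1 (g_gt0 x); lra.
Qed.

(** By [density_inv] the logarithm of the reverse density is [- ln g]; the mean-zero correction is
    now [g - 1]. *)
Lemma KL_density_rev : KL Q P = \int[Q]_x (g x - 1 - ln (g x))%:E.
Proof.
transitivity (\int[Q]_x (- ln (g x))%:E).
  apply: ae_eq_integral => //.
  - exact/measurable_lne/mD.
  - by apply/measurable_EFinP; exact: measurableT_comp.
  - apply: filterS density_inv => x /[apply] ->.
    by rewrite lne_EFin ?invr_gt0// lnV ?posrE.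
rewrite (integral_addr_mean0 (k := fun x => g x - 1)%R).
- by apply: eq_integral => x _; congr (_%:E); ring.
- exact: measurableT_comp.
- exact: (integrableB _ integrable_density (finite_measure_integrable_cst _ 1 _)).
- under eq_integral do rewrite EFinB.
  rewrite integralB_EFin//.
  + rewrite integral_density1 (integral_cst Q measurableT 1) mul1e.
    by rewrite [X in _ - X]probability_setT subee.
  + exact: integrable_density.
  + exact: (finite_measure_integrable_cst Q 1 measurableT).
- by move=> x; have := ln_le_subr1 (g_gt0 x); lra.
Qed.

Lemma variance_density : 'V_Q[g] = \int[Q]_x ((g x - 1) ^+ 2)%:E.
Proof.
by rewrite /variance unlock !unlock integral_density1.
Qed.

End positive_density.

(** * From bounds on ratios of measures to bounds on integrals *)

Section measure_ratios.
Context {d : measure_display} {T : measurableType d} {R : realType}.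
Variables (P Q : probability T R).

Let m := ereal_inf (measure_ratios P Q).
Let M : \bar R := ereal_sup (measure_ratios P Q).

(** Taking the whole space gives [m <= 1 <= M]; hence [m] is a real number and [M] is not [-oo]. *)
Lemma measure_ratios1 : measure_ratios P Q 1.
Proof.
exists setT; first by split=> //=; rewrite [X in _ < X]probability_setT.
rewrite [X in X / _]probability_setT [X in _ / X]probability_setT.
by rewrite inver oner_eq0 invr1 mul1e.
Qed.

Lemma ereal_inf_measure_ratios_ge0 : 0 <= m.
Proof.
apply: le_ereal_inf_tmp => _ [A [mA QA] <-].
by rewrite mule_ge0// inve_ge0.
Qed.

Lemma ereal_inf_measure_ratios_le1 : m <= 1.
Proof. exact/ereal_inf_lbound/measure_ratios1. Qed.

Lemma ereal_sup_measure_ratios_ge1 : 1 <= M.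
Proof. exact/ereal_sup_ubound/measure_ratios1. Qed.

Lemma ereal_inf_measure_ratiosP (A : set T) : measurable A -> m * Q A <= P A.
Proof.
move=> mA; have [->|] := eqVneq (Q A) 0; first by rewrite mule0.
rewrite -measure_gt0 => QA.
have [q qE] : exists q, Q A = q%:E.
  by exists (fine (Q A)); rewrite fineK ?fin_num_measure.
have q0 : (0 < q)%R by rewrite -lte_fin -qE.
have : m <= P A / Q A.
  by apply: ereal_inf_lbound; exists A.
rewrite !qE.
by rewrite inver gt_eqF// lee_pdivlMr.
Qed.

Lemma ereal_sup_measure_ratiosP (A : set T) : P `<< Q ->
  measurable A -> P A <= M * Q A.
Proof.
move=> /null_content_dominatesP PQ mA.
(* The supremum ignores [Q]-null sets; these are [P]-null by absolute continuity. *)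
have [QA0|] := eqVneq (Q A) 0; first by rewrite PQ// QA0 mule0.
rewrite -measure_gt0 => QA.
have [q qE] : exists q, Q A = q%:E.
  by exists (fine (Q A)); rewrite fineK ?fin_num_measure.
have q0 : (0 < q)%R by rewrite -lte_fin -qE.
have : P A / Q A <= M.
  by apply: ereal_sup_ubound; exists A.
rewrite !qE.
by rewrite inver gt_eqF// lee_pdivrMr.
Qed.

Lemma ge0_integral_inf_measure_ratios (f : T -> \bar R) :
  measurable_fun setT f -> (forall x, 0 <= f x) ->
  m * \int[Q]_x f x <= \int[P]_x f x.
Proof.
move=> mf f0; have := ereal_inf_measure_ratiosP.
have := ereal_inf_measure_ratios_ge0; have := ereal_inf_measure_ratios_le1.
case: m => // r _; rewrite lee_fin => r0 rP.
(* The factor is absorbed into the scaled measure [r Q], which lies below [P] on every measurable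
   set. *)
rewrite -[r]/((NngNum r0)%:num)%R -ge0_integral_mscale//.
exact: ge0_le_measure_integral.
Qed.

Lemma ge0_integral_sup_measure_ratios (f : T -> \bar R) : P `<< Q ->
  measurable_fun setT f -> (forall x, 0 <= f x) ->
  \int[P]_x f x <= M * \int[Q]_x f x.
Proof.
move=> PQ mf f0; have := fun A => @ereal_sup_measure_ratiosP A PQ.
have := ereal_sup_measure_ratios_ge1.
case: M => [r|_ _|//].
- rewrite lee_fin => r1 rP.
  have r0 : (0 <= r)%R by rewrite (le_trans _ r1).
  rewrite -[r]/((NngNum r0)%:num)%R -ge0_integral_mscale//.
  exact: ge0_le_measure_integral.
(* For [M = +oo] the bound is trivial unless the [Q]-integral is 0. Then [0 * +oo = 0], and [f]
   vanishes [Q]-a.e., hence [P]-a.e. *)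
- have [Qf0|] := eqVneq (\int[Q]_x f x) 0; last first.
    by move=> Qf; rewrite gt0_mulye ?leey// lt0e Qf integral_ge0.
  rewrite Qf0 mule0 (ae_eq_integral (cst 0)) ?integral0//.
  apply: (null_dominates_ae_eq measurableT PQ).
  apply/ae_eq_integral_abs => //.
  by under eq_integral do rewrite gee0_abs//.
Qed.

End measure_ratios.

(** * Integrals of affine combinations *)

Section affine.
Context {d : measure_display} {T : measurableType d} {R : realType}.
Variables (Q : probability T R) (f h : T -> R) (a b c : R).
Hypotheses (intf : Q.-integrable setT (EFin \o f))
  (inth : Q.-integrable setT (EFin \o h)).

Let inta : Q.-integrable setT (EFin \o (fun x => a * f x)%R).
Proof. exact: (integrableZl measurableT a intf). Qed.

Let intb : Q.-integrable setT (EFin \o (fun x => b * h x)%R).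
Proof. exact: (integrableZl measurableT b inth). Qed.

Let intab : Q.-integrable setT (EFin \o (fun x => a * f x + b * h x)%R).
Proof. exact: (integrableD measurableT inta intb). Qed.

Let intc : Q.-integrable setT (EFin \o cst c).
Proof. exact: finite_measure_integrable_cst. Qed.

Lemma integrable_affine :
  Q.-integrable setT (EFin \o (fun x => a * f x + b * h x + c)%R).
Proof. exact: (integrableD measurableT intab intc). Qed.

Lemma integral_affine : \int[Q]_x (a * f x + b * h x + c)%:E =
  a%:E * \int[Q]_x (f x)%:E + b%:E * \int[Q]_x (h x)%:E + c%:E.
Proof.
rewrite -(integralZl measurableT intf) -(integralZl measurableT inth).
rewrite -(integralD measurableT inta intb).
have <- : \int[Q]_x (cst c x)%:E = c%:E.
  rewrite (integral_cst Q measurableT c%:E) [X in _ * X]probability_setT.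
  by rewrite mule1.
by rewrite -(integralD measurableT intab intc).
Qed.

End affine.

(** * The two bounds on the variance of the density *)

Section jensen_gap.
Context {d : measure_display} {T : measurableType d} {R : realType}.
Variables (P Q : probability T R) (g : T -> R).
Hypotheses (PQ : P `<< Q) (QP : Q `<< P).
Hypotheses (mg : measurable_fun setT g) (g_gt0 : forall x, (0 < g x)%R).
Hypothesis dPQ : ae_eq Q setT (density P Q) (EFin \o g).

Let mln : measurable_fun setT (fun x => ln (g x)).
Proof. exact: measurableT_comp. Qed.

Let u x := (g x - 1 - ln (g x))%R.

Let u_ge0 x : (0 <= u x)%R.
Proof. by have := ln_le_subr1 (g_gt0 x); rewrite /u; lra. Qed.

Let mu : measurable_fun setT u.
Proof. by apply: measurable_funB => //; exact: measurable_funB. Qed.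

(** Moves everything under [Q]; both integrands are nonnegative, so the integrals add even when
    infinite. *)
Lemma integralD_KL_density (h : T -> R) :
  measurable_fun setT h -> (forall x, 0 <= h x)%R ->
  \int[P]_x (h x)%:E + KL P Q =
  \int[Q]_x (g x * h x + (g x * ln (g x) - g x + 1))%:E.
Proof.
move=> mh h0; rewrite (integral_positive_density PQ mg g_gt0 dPQ mh).
rewrite (KL_density PQ mg g_gt0 dPQ) -ge0_integralD//.
- by move=> x _; rewrite lee_fin mulr_ge0// ltW.
- by apply/measurable_EFinP; exact: measurable_funM.
- by move=> x _; rewrite lee_fin; have := mul_ln_ge_subr1 (g_gt0 x); lra.
- apply/measurable_EFinP; apply: measurable_funD => //.
  by apply: measurable_funB => //; exact: measurable_funM.
Qed.

Lemma variance_density_le :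
  'V_Q[g] <=
  ereal_sup (measure_ratios P Q) * KL Q P + KL P Q.
Proof.
have -> : 'V_Q[g] = \int[P]_x (u x)%:E + KL P Q.
  rewrite integralD_KL_density// (variance_density PQ mg g_gt0 dPQ).
  by apply: eq_integral => x _; congr (_%:E); rewrite /u; ring.
rewrite leeD2r// (KL_density_rev PQ QP mg g_gt0 dPQ).
by apply: ge0_integral_sup_measure_ratios => //; exact/measurable_EFinP.
Qed.

Lemma expeR_KL_le_variance_density :
  expeR (ereal_inf (measure_ratios P Q) * KL Q P + KL P Q) <= 1 + 'V_Q[g].
Proof.
have [Voo|] := ltP ('V_Q[g]) +oo; last first.
  by rewrite leye_eq => /eqP ->; rewrite addey ?leey.
have ig := integrable_density PQ mg g_gt0 dPQ.
have g1 := integral_density1 PQ mg g_gt0 dPQ.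
have := variance_ge0 Q g; move: Voo; rewrite (variance_density PQ mg g_gt0 dPQ).
set S := fun x => ((g x - 1) ^+ 2)%R => Soo S0.
have iS : Q.-integrable setT (EFin \o S).
  apply/integrableP; split.
    by apply/measurable_EFinP; apply: measurable_funX; exact: measurable_funB.
  by under eq_integral do rewrite gee0_abs ?lee_fin ?sqr_ge0//.
have [v vE] : exists v, \int[Q]_x (S x)%:E = v%:E.
  by exists (fine (\int[Q]_x (S x)%:E)); rewrite fineK// ge0_fin_numE.
move: S0; rewrite /S vE lee_fin => v0.
(* Since [g] has [Q]-mean 1, [a] is the [Q]-integral of [g ^+ 2], that is the [P]-mean of [g]. *)
pose a := (1 + v)%R.
have a0 : (0 < a)%R by rewrite /a; lra.
pose t x := (ln a + g x / a - 1 - ln (g x))%R.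
have mt : measurable_fun setT t.
  apply: measurable_funB => //; apply: measurable_funB => //.
  by apply: measurable_funD => //; exact: measurable_funM.
have t_ge0 x : (0 <= t x)%R.
  have := @ln_le_subr1 R (g x / a); rewrite divr_gt0// => /(_ isT).
  by rewrite ln_div ?posrE// /t; lra.
(* The difference [t - u] is affine in [g], with [Q]-mean [a^-1 - 1 + ln a], nonnegative by
   [ln_le_subr1] at [a^-1]. The coefficient 0 of [S] only fits it to [integral_affine]. *)
have ut : \int[Q]_x (u x)%:E <= \int[Q]_x (t x)%:E.
  have tuE : (t \- u)%R = (fun x => 0 * S x + (a^-1 - 1) * g x + ln a)%R.
    by apply/funext => x /=; rewrite /t /u; ring.
  apply: le_integral_of_diff => //.
    by rewrite tuE; exact: integrable_affine.
  rewrite -[X in _ <= \int[Q]_x (X x)%:E]/(t \- u)%R tuE integral_affine//.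
  rewrite mul0e add0e g1 mule1 -EFinD lee_fin.
  have := @ln_le_subr1 R a^-1; rewrite invr_gt0 => /(_ a0).
  by rewrite lnV ?posrE//; lra.
(* The terms [g * ln g] cancel, leaving a polynomial in [g] that is affine in [S] and [g]. Its
   integral is [ln a + (1 + v) / a - 1], which is [ln a] by the choice of [a]. *)
have tE : \int[P]_x (t x)%:E + KL P Q = (ln a)%:E.
  rewrite integralD_KL_density//.
  under eq_integral => x _.
    have -> : (g x * t x + (g x * ln (g x) - g x + 1) =
      a^-1 * S x + (ln a + 2 / a - 2) * g x + (1 - a^-1))%R.
      by rewrite /t /S; ring.
    over.
  rewrite integral_affine// vE g1 mule1 -EFinM -!EFinD; congr (_%:E).
  have : (a^-1 * a = 1)%R by rewrite mulVf// gt_eqF.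
  by rewrite {2}/a; lra.
(* Writing [1 + v] as [expR (ln a)] reduces the goal to comparing exponents, where [tE] replaces
   [ln a]. *)
rewrite -EFinD -[(1 + v)%R]/a -[X in X%:E](lnK (x := a)) ?posrE//.
rewrite -[(expR _)%:E]/(expeR (ln a)%:E) lee_expeR -tE leeD2r//.
rewrite (KL_density_rev PQ QP mg g_gt0 dPQ).
apply: (@le_trans _ _ (ereal_inf (measure_ratios P Q) * \int[Q]_x (t x)%:E)).
  by rewrite lee_wpmul2l// ereal_inf_measure_ratios_ge0.
apply: ge0_integral_inf_measure_ratios; first exact/measurable_EFinP.
by move=> x; rewrite lee_fin.
Qed.

Lemma sqrte_variance_density_bounds :
  sqrte (expeR (ereal_inf (measure_ratios P Q) * KL Q P + KL P Q) - 1)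
    <= sqrte 'V_Q[g]
    <= sqrte (expeR (ereal_sup (measure_ratios P Q) * KL Q P + KL P Q) - 1).
Proof.
have V0 := variance_ge0 Q g.
have := expeR_ge1Dx (ereal_sup (measure_ratios P Q) * KL Q P + KL P Q).
have := variance_density_le; set e := ereal_sup _ * _ + _ => Ve e1.
have Ve1 : 'V_Q[g] <= expeR e - 1.
  by rewrite leeBrDr// addeC (le_trans _ e1)// leeD2l.
apply/andP; split; rewrite lee_sqrt//; last exact: le_trans Ve1.
by rewrite leeBlDl//; exact: expeR_KL_le_variance_density.
Qed.

End jensen_gap.

(** * The optimal proposal and the reduction of the relative error to [g] *)

Lemma integral_gt0_eq0 (R : realType) (d : measure_display)
    (T : measurableType d) (mu : {measure set T -> \bar R}) (f : T -> R)
    (A : set T) :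
  measurable A -> measurable_fun A f -> (forall x, 0 < f x)%R ->
  \int[mu]_(x in A) (f x)%:E = 0 -> mu A = 0.
Proof.
move=> mA mf f0 If; have /ae_eq_integral_abs : \int[mu]_(x in A) `|(f x)%:E| = 0.
  by rewrite -[RHS]If; apply: eq_integral => x _; rewrite gee0_abs// lee_fin ltW.
move=> /(_ mA) [|B [mB B0 AB]]; first exact/measurable_EFinP.
apply: (subset_measure0 mA mB _ B0) => x Ax; apply: AB => /= /(_ Ax) [].
by apply/eqP; rewrite gt_eqF.
Qed.

Lemma ae_eq_variance (R : realType) (d : measure_display)
    (T : measurableType d) (P : probability T R) (X Y : T -> R) :
  measurable_fun setT X -> measurable_fun setT Y ->
  ae_eq P setT X Y -> 'V_P[X] = 'V_P[Y].
Proof.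
move=> mX mY XY; rewrite /variance !unlock.
have -> : \int[P]_w (X w)%:E = \int[P]_w (Y w)%:E.
  apply: ae_eq_integral => //; try exact/measurable_EFinP.
  by apply: filterS XY => x /[apply] ->.
set c := fine _; apply: ae_eq_integral => //.
- by apply/measurable_EFinP; apply: measurable_funM; exact: measurable_funB.
- by apply/measurable_EFinP; apply: measurable_funM; exact: measurable_funB.
- by apply: filterS XY => x /[apply] /= xy; congr (_%:E); rewrite !fctE /= xy.
Qed.

Section optimal_proposal.
Context {d : measure_display} {T : measurableType d} {R : realType}.
Variables (nu nustar nutilde : probability T R) (W : T -> R).
Hypotheses (mW : measurable_fun setT W).
Hypothesis Zoo : partition_function nu W < +oo.
Hypothesis opt : is_optimal_proposal nu W nustar.

Let mexpN : measurable_fun setT (fun x => expR (- W x)).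
Proof. by apply: measurableT_comp => //; exact: measurableT_comp. Qed.

Let ZE : partition_function nu W = \int[nu]_x (expR (- W x))%:E.
Proof. by rewrite /partition_function unlock. Qed.

(** A zero integral of the positive function [expR (- W x)] would make the whole space [nu]-null. *)
Lemma partition_function_gt0 : 0 < partition_function nu W.
Proof.
rewrite ZE lt0e; apply/andP; split; last first.
  by apply: integral_ge0 => x _; rewrite lee_fin expR_ge0.
apply/eqP => Z0; have := integral_gt0_eq0 measurableT mexpN (fun x => expR_gt0 _) Z0.
by rewrite [X in X = _]probability_setT => /eqP; rewrite onee_eq0.
Qed.

Lemma partition_functionE : exists2 z, (0 < z)%R & partition_function nu W = z%:E.
Proof.
have Z0 := partition_function_gt0.
exists (fine (partition_function nu W)); first by rewrite fine_gt0// Z0 Zoo.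
by rewrite fineK// ge0_fin_numE// ltW.
Qed.

Lemma density_optimal_proposal z : (0 < z)%R -> partition_function nu W = z%:E ->
  ae_eq nu setT (density nustar nu) (fun x => (expR (- W x) / z)%:E).
Proof.
move=> z0 Zz; have [_] := opt; apply: filterS => x /[apply] ->.
by rewrite Zz inver gt_eqF.
Qed.

(** The density of [nustar] is a.e. a strictly positive function, so its integral over a set
    vanishes only if that set is [nu]-null. *)
Lemma null_dominates_optimal_proposal : nu `<< nustar.
Proof.
have [z z0 Zz] := partition_functionE.
apply/null_content_dominatesP => A mA A0.
have mf : measurable_fun A (fun x => expR (- W x) / z)%R.
  by apply: measurable_funTS; exact: measurable_funM.
apply: (@integral_gt0_eq0 _ _ _ nu _ _ mA mf) => [x|].
  by rewrite divr_gt0// expR_gt0.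
rewrite -[RHS]A0; have [nsnu _] := opt.
transitivity (\int[nu]_(x in A) density nustar nu x); last first.
  by rewrite /density -Radon_Nikodym_integral.
apply: ae_eq_integral => //.
- exact/measurable_EFinP.
- by apply: measurable_funTS; apply: measurable_int; exact: Radon_Nikodym_integrable.
- by apply: ae_eq_sym; exact: (ae_eq_subset _ (density_optimal_proposal z0 Zz)).
Qed.

(** By the chain rule the importance weight is a.e. [z * g] with [z] the partition function, and the
    factor [z] leaving the square root cancels the normalisation. *)
Lemma relative_error_density (g : T -> R) :
  nutilde `<< nu -> nu `<< nutilde ->
  measurable_fun setT g -> (forall x, 0 < g x)%R ->
  ae_eq nutilde setT (density nustar nutilde) (EFin \o g) ->
  relative_error nu W nutilde = sqrte 'V_nutilde[g].
Proof.
move=> ntnu nunt mg g0 dg; have [nsnu _] := opt.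
have [z z0 Zz] := partition_functionE.
have nsnt := null_dominates_trans nsnu nunt.
have md : measurable_fun setT (density nu nutilde).
  by apply: measurable_int; exact: Radon_Nikodym_integrable.
have Xzg : ae_eq nutilde setT
    (fun x => expR (- W x) * fine (density nu nutilde x))%R (fun x => z * g x)%R.
  have := null_dominates_ae_eq measurableT ntnu (density_optimal_proposal z0 Zz).
  have := @Radon_Nikodym_chain_rule _ _ _ (charge_of_finite_measure nustar)
    nutilde nu nsnu nunt.
  move: dg; apply: filterS3 => x + + + _ => /(_ I) d1 /(_ I) d2 /(_ I) d3.
  move: d2; rewrite -!/(density _ _ _) /= -/(density _ _ _) d1 d3.
  have : density nu nutilde x \is a fin_num by exact: Radon_Nikodym_fin_num.
  rewrite /density; case: Radon_Nikodym => // r _ /= [->].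
  by field; rewrite gt_eqF.
rewrite /relative_error Zz (ae_eq_variance _ _ Xzg); first last.
- exact: measurable_funM.
- by apply: measurable_funM => //; exact: measurableT_comp.
(* The scaling is done on integrals of nonnegative squares, so it also holds for infinite
   variance. *)
have -> : 'V_nutilde[fun x => z * g x]%R = z%:E ^+ 2 * 'V_nutilde[g].
  rewrite (variance_density nsnt mg g0 dg) /variance unlock !unlock.
  have -> : \int[nutilde]_w (z * g w)%:E = z%:E.
    rewrite -[RHS]mule1 -(integral_density1 nsnt mg g0 dg).
    exact: (integralZl measurableT (integrable_density nsnt mg g0 dg) z).
  rewrite -EFin_expe -ge0_integralZl_EFin ?sqr_ge0//.
  - apply: eq_integral => x _; rewrite -EFinM; congr (_%:E).
    by rewrite -[LHS]/((z * g x - z) * (z * g x - z))%R; ring.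
  - by move=> x _; rewrite lee_fin sqr_ge0.
  - by apply/measurable_EFinP; apply: measurable_funX; exact: measurable_funB.
rewrite sqrteM ?expe_ge0 ?lee_fin ?ltW// sqrte_sqr gee0_abs ?lee_fin ?ltW//.
by rewrite muleA inver gt_eqF// -EFinM mulVf ?mul1e// gt_eqF.
Qed.

End optimal_proposal.

Theorem proposition2p7 (R : realType) (d : measure_display)
    (T : measurableType d) (nu : probability T R)
    (W : T -> R) (hW : measurable_fun setT W)
    (hZ : partition_function nu W < +oo)
    (nustar : probability T R) (hnustar : is_optimal_proposal nu W nustar)
    (nutilde : probability T R)
    (hnutilde_nu : nutilde `<< nu) (hnu_nutilde : nu `<< nutilde) :
  let m := ereal_inf (measure_ratios nustar nutilde) in
  let M := ereal_sup (measure_ratios nustar nutilde) in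
  sqrte (expeR (m * KL nutilde nustar + KL nustar nutilde) - 1)
    <= relative_error nu W nutilde
    <= sqrte (expeR (M * KL nutilde nustar + KL nustar nutilde) - 1).
Proof.
cbv zeta.
have PQ : nustar `<< nutilde := null_dominates_trans hnustar.1 hnu_nutilde.
(* Mutual absolute continuity is what provides a density positive everywhere. *)
have QP : nutilde `<< nustar.
  exact: null_dominates_trans hnutilde_nu
    (null_dominates_optimal_proposal hW hZ hnustar).
have [g [mg g0 dPQ]] := density_gt0_version PQ QP.
rewrite (relative_error_density hW hZ hnustar hnutilde_nu hnu_nutilde mg g0 dPQ).
exact: sqrte_variance_density_bounds.
Qed.
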